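(* For each small enough $\epsilon>0$ let $\epsilon_0=\epsilon^{2\epsilon^{-1}}$. Then for each non-decreasing $1$-Lipschitz function $f:[0,1]\to[0,1]$ there exist a partition $$0=A_1<A_2<\ldots<A_{L+1}=1$$ and a sequence $$0\le t_1<t_2<\ldots<t_L\le1$$ such that for each $1\le l\le L$ $$A_{l+1}-A_l\ge\epsilon_0\epsilon^{-1},$$ $$f(x)\ge f(A_l)+t_l(x-A_l)-\epsilon(A_{l+1}-A_l)\quad\text{for all }A_l\le x\le A_{l+1},$$ $$f(A_{l+1})\le f(A_l)+(t_l+3\epsilon)(A_{l+1}-A_l),$$ and moreover $$t_1\le f(1)-f(0)+\epsilon.$$
   Context: ''For each small enough $\epsilon>0$'' means that there is an absolute $\epsilon^*>0$ such that the statement holds for all $0<\epsilon\le\epsilon^*$. *)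

(* Defs.v *)
From mathcomp Require Export all_boot all_order all_algebra.
From mathcomp Require Export all_classical all_reals all_analysis.
Export Order.TTheory GRing.Theory Num.Theory.
Export numFieldNormedType.Exports.

(* Main.v *)
(* Let [a_i] minimise [f x - 2 eps i x] over [0, 1]. The [a_i] increase from 0 to
   1, the graph of [f] lies above the line of slope [2 eps i] through
   [(a_i, f a_i)], and comparing with the next minimiser shows that the mean slope
   of [f] on [[a_i, a_{i+1}]] is at most [2 eps (i + 1)]. There are at most [1 / eps]
   such intervals, so by pigeonhole there is a scale [T >= eps0 / eps] such that each
   of them is either longer than [T] or shorter than [eps^2 T]. The short ones have
   total length at most [eps T], and are merged into the preceding long interval
   (into the first long one if there is none), at a cost of [eps] in the slopes. *)
From mathcomp Require Import zify ring lra.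
Require Import Defs.
Local Open Scope classical_set_scope.
Local Open Scope ring_scope.

(** A minimiser exists by compactness but need not be unique, so both ends are pinned: [0] is one
    for slope 0 because [f] is non-decreasing, and [1] is one for slope [delta * N >= 1] because [f]
    is 1-Lipschitz. *)
Lemma slope_minimizers (R : realType) (f : R -> R) (delta : R) (N : nat) :
  {in `[0, 1] &, {homo f : x y / x <= y}} ->
  {in `[0, 1] &, forall x y, `|f x - f y| <= `|x - y|} ->
  1 <= delta * N%:R ->
  exists a : nat -> R, [/\ a 0%N = 0, a N = 1 &
    forall i, a i \in `[0, 1] /\
      {in `[0, 1], forall x, f (a i) + delta * i%:R * (x - a i) <= f x}].
Proof.
move=> fhomo flip dN1.
have in0 : (0 : R) \in `[0, 1] by rewrite in_itv /= lexx ler01.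
have in1 : (1 : R) \in `[0, 1] by rewrite in_itv /= lexx ler01.
pose P (i : nat) (z : R) := [/\ i = 0%N -> z = 0, i = N -> z = 1, z \in `[0, 1] &
  {in `[0, 1], forall x, f z + delta * i%:R * (x - z) <= f x}].
suff /choice[a aP] : forall i, exists z, P i z.
  exists a; split; first by have [->] := aP 0%N.
    by have [_ ->] := aP N.
  by move=> i; have [] := aP i.
move=> i.
have [i0|i0] := eqVneq i 0%N.
  exists 0; split=> //.
    by move=> iN; move: dN1; rewrite -iN i0 mulr0 ler10.
  move=> x x01; rewrite i0 mulr0 mul0r addr0; apply: fhomo => //.
  by move: x01; rewrite in_itv /= => /andP[].
have [iN|iN] := eqVneq i N.
  exists 1; split=> //; first by move=> i0'; rewrite i0' eqxx in i0.
  move=> x x01; rewrite iN.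
  have := flip _ _ in1 x01; rewrite ler_norml => /andP[_].
  move: x01; rewrite in_itv /= => /andP[x0 x1].
  rewrite ger0_norm ?subr_ge0// => f1x.
  have : 0 <= (delta * N%:R - 1) * (1 - x) by rewrite mulr_ge0 ?subr_ge0.
  lra.
have [|z z01 zmin] := @EVT_min R (fun x => f x - delta * i%:R * x) 0 1 ler01.
  apply/subspace_continuousP => x /= x01.
  apply: (@cvgB _ R); last first.
    by apply: cvgM; [exact: cvg_cst | apply: cvg_within].
  apply/cvgrPdist_le => e e0.
  rewrite near_withinE; near=> y => y01.
  apply: (le_trans (flip _ _ x01 y01)).
  near: y; have /cvgrPdist_le /(_ e e0) : (id : R -> R) @ x --> x by exact: cvg_id.
  exact.
exists z; split=> //.
- by move=> i0'; rewrite i0' eqxx in i0.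
- by move=> iN'; rewrite iN' eqxx in iN.
- by move=> x x01; have := zmin x x01; lra.
Unshelve. all: by end_near. Qed.

(* The [N] disjoint bands [tau j.+1 <= _ < tau j] cannot all be hit by [N]
   values one of which lies above every band. *)
Lemma empty_band (R : realDomainType) (d : nat -> R) (tau : nat -> R) (N : nat) :
  {homo tau : i j / (i <= j)%N >-> j <= i} ->
  (exists2 i, (i < N)%N & tau 0%N <= d i) ->
  exists2 j, (j < N)%N &
    forall i, (i < N)%N -> d i < tau j -> d i < tau j.+1.
Proof.
move=> tau_anti [i0 i0N di0].
pose hit (j i : 'I_N) := tau j.+1 <= d i < tau j.
have [/forallP hitj|] := boolP [forall j, exists i, hit j i]; last first.
  move=> /forallPn[j /existsPn nhit]; exists j => // i iN dij.
  by have := nhit (Ordinal iN); rewrite /hit /= dij andbT -ltNge.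
have /choice[h hP] : forall j, exists i, hit j i by move=> j; exact/existsP.
have h_inj : injective h.
  move=> j k hjk; apply/val_inj; move: (hP j) (hP k); rewrite /hit hjk.
  move=> /andP[j1 j2] /andP[k1 k2].
  have [jk|kj|//] := ltngtP (val j) (val k).
    by have := le_lt_trans (le_trans (tau_anti _ _ jk) j1) k2; rewrite ltxx.
  by have := le_lt_trans (le_trans (tau_anti _ _ kj) k1) j2; rewrite ltxx.
have /codomP[j jE] := injF_onto h_inj (Ordinal i0N).
have /andP[_] := hP j; rewrite -jE /= ltNge.
by rewrite (le_trans (tau_anti _ _ (leq0n j))).
Qed.

(** Induction on [N]: the sentinel [b L = N] moves up by one, and the old one stays in the list
    exactly when it satisfies [P]. The sentinel will supply the right endpoint of the last merged
    interval. *)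
Lemma enum_below (P : pred nat) (N : nat) :
  exists (L : nat) (b : nat -> nat), [/\ b L = N,
    forall l, (l < L)%N -> P (b l) /\ (b l < b l.+1 <= N)%N,
    forall l j, (l < L)%N -> (b l < j < b l.+1)%N -> ~~ P j &
    forall j, (j < b 0%N)%N -> ~~ P j].
Proof.
elim: N => [|N [L [b [bL bP gap gap0]]]].
  by exists 0%N, (fun=> 0%N).
have [PN|PN] := boolP (P N).
  exists L.+1, (fun l => if l == L.+1 then N.+1 else b l); split=> //=.
  - by rewrite eqxx.
  - move=> l lL; rewrite (ltn_eqF lL) eqSS.
    have [->|neq] := eqVneq l L; first by rewrite bL leqnn.
    by have [|? ?] := bP l; [lia | split=> //; lia].
  - move=> l j lL; rewrite (ltn_eqF lL) eqSS.
    have [->|neq] := eqVneq l L; first by rewrite bL; lia.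
    by apply: gap; lia.
exists L, (fun l => if l == L then N.+1 else b l); split.
- by rewrite eqxx.
- move=> l lL; rewrite (ltn_eqF lL); have [Pl bl] := bP l lL; split=> //.
  by case: eqP; lia.
- move=> l j lL; rewrite (ltn_eqF lL); case: eqP => [lL'|_]; last exact: gap.
  have [->//|jN] := eqVneq j N.
  by move=> bj; apply: (gap l) => //; rewrite lL' bL; lia.
- move=> j; case: eqP => [L0|_]; last exact: gap0.
  have [->//|jN ?] := eqVneq j N.
  by apply: gap0; rewrite L0 bL; lia.
Qed.

Lemma increment_le (R : realDomainType) (a : nat -> R) (eta : R) (m n : nat) :
  (m <= n)%N -> (forall j, (m <= j < n)%N -> a j.+1 - a j <= eta) ->
  a n - a m <= eta *+ (n - m).
Proof.
move=> mn small; rewrite -telescope_sumr// -sumr_const_nat.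
by rewrite big_nat [leRHS]big_nat; apply: ler_sum.
Qed.

Theorem lemma2p11 (R : realType) :
  exists2 eps_star : R, 0 < eps_star &
  forall eps : R, 0 < eps -> eps <= eps_star ->
  let eps0 : R := eps `^ (2 * eps^-1) in
  forall f : R -> R,
    (forall x, x \in `[0, 1] -> f x \in `[0, 1]) ->
    {in `[0, 1] &, {homo f : x y / x <= y}} ->
    1.-lipschitz_(`[0, 1]) f ->
  exists (L : nat) (A t : nat -> R),
    (0 < L)%N /\
    (A 1%N = 0 /\ A L.+1 = 1 /\
      forall l, (1 <= l <= L)%N -> A l < A l.+1) /\
    (0 <= t 1%N /\ t L <= 1 /\
      forall l, (1 <= l < L)%N -> t l < t l.+1) /\
    (forall l, (1 <= l <= L)%N ->
      [/\ A l.+1 - A l >= eps0 * eps^-1,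
          forall x, A l <= x <= A l.+1 ->
            f x >= f (A l) + t l * (x - A l) - eps * (A l.+1 - A l) &
          f (A l.+1) <= f (A l) + (t l + 3 * eps) * (A l.+1 - A l)]) /\
    t 1%N <= f 1 - f 0 + eps.
Proof.
exists 2^-1 => // eps eps_gt0 eps_le eps0 f _ fhomo flip'.
have flip : {in `[0, 1] &, forall x y, `|f x - f y| <= `|x - y|}.
  move=> x y x01 y01.
  have xy01 : ([set` `[0, 1]] `*` [set` `[0, 1]]) (x, y) by split.
  by have := flip' _ xy01; rewrite /= mul1r.
have eps_ge0 := ltW eps_gt0.
have in0 : (0 : R) \in `[0, 1] by rewrite in_itv /= lexx ler01.
have in1 : (1 : R) \in `[0, 1] by rewrite in_itv /= lexx ler01.
(* The slope at index [N] reaches 1, which pins [a N = 1], while the earlier slopes are at most 1,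
   as [t L <= 1] demands. *)
have [N [N_gt0 N_gt N_le]] : exists N,
    [/\ (0 < N)%N, 1 <= 2 * eps * N%:R & 2 * eps * N.-1%:R <= 1].
  exists (Num.truncn (2 * eps)^-1).+1.
  have e2_gt0 : 0 < 2 * eps by rewrite mulr_gt0.
  have /andP[le lt] := @truncn_itv R (2 * eps)^-1 (ltW (eqbRL (invr_gt0 _) e2_gt0)).
  by split=> //; rewrite [_ * _%:R]mulrC -?(ler_pdivrMr _ _ e2_gt0)
    -?(ler_pdivlMr _ _ e2_gt0) div1r// ltW.
have NE : N%:R = N.-1%:R + 1 :> R by rewrite natr1 prednK.
have epsN : eps * N%:R <= 1 by rewrite NE; lra.
have [a [a0 aN amin]] := @slope_minimizers R f (2 * eps) N fhomo flip N_gt.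
have a01 i : 0 <= a i <= 1 by have [] := amin i; rewrite in_itv.
(* Each of the two minimisers is tested at the other, and the inequalities are added. *)
have aS i : a i <= a i.+1.
  have [ai mini] := amin i; have [aSi minSi] := amin i.+1.
  have := minSi _ ai; have := mini _ aSi; rewrite -natr1 => le1 le2.
  have : 0 <= 2 * eps * (a i.+1 - a i) by lra.
  by rewrite pmulr_rge0 ?mulr_gt0// subr_ge0.
have amono : {homo a : i j / (i <= j)%N >-> i <= j} by exact: homo_leq lexx le_trans aS.
(* The bands have endpoints [eps ^+ (2 j + 1)], a factor [eps ^+ 2] apart. Some gap is at least
   [eps], since otherwise the [N] gaps would add up to less than [eps * N <= 1]. *)
have [j jN gapj] : exists2 j, (j < N)%N & forall i, (i < N)%N ->
    a i.+1 - a i < eps ^+ j.*2.+1 -> a i.+1 - a i < eps ^+ j.+1.*2.+1.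
  apply: empty_band.
    by move=> i k ik; apply: ler_wiXn2l; [lra | lra | rewrite ltnS leq_double].
  apply: contrapT => /forall2NP small.
  have {}small i : (i < N)%N -> a i.+1 - a i < eps.
    by move=> iN; have [//|/negP] := small i; rewrite -ltNge expr1.
  have := @increment_le R a eps 0 N.-1 (leq0n _).
  rewrite a0 subr0 subn0 -mulr_natr => /(_ _)/wrap[i /andP[_ iN]|].
    by apply/ltW/small; rewrite (ltn_trans iN)// prednK.
  have := small N.-1; rewrite prednK// aN => /(_ (leqnn _)).
  have : eps * N%:R = eps * N.-1%:R + eps by rewrite NE mulrDr mulr1.
  lra.
pose T := eps ^+ j.*2.+1.
have T_gt0 : 0 < T by exact: exprn_gt0.
have T_le1 : T <= 1 by apply: exprn_ile1; lra.
have eps01 : 0 < eps <= 1 by rewrite eps_gt0; lra.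
(* Since [j < N] and [eps * N <= 1], the exponent [2 j + 2] of [T * eps] is at most
   [2 N <= 2 / eps]. *)
have eps0_le : eps0 * eps^-1 <= T.
  rewrite ler_pdivrMr// -exprSr -doubleS /eps0.
  apply: (@le_trans _ _ (eps ^+ N.*2)); last first.
    by apply: ler_wiXn2l; [lra | lra | rewrite leq_double].
  rewrite -(powR_mulrn _ eps_ge0); apply: (ger_powR eps01).
  rewrite ler_pdivlMr// -mul2n natrM; lra.
have epsT : 0 <= eps * T /\ eps * T <= eps.
  by split; [exact: mulr_ge0 eps_ge0 (ltW T_gt0) | rewrite ger_pMr].
have [L [b [bL bP bgap bgap0]]] := enum_below (fun i => T <= a i.+1 - a i) N.
(* At most [N] short gaps, each below [eps ^+ 2 * T], and [eps * N <= 1]. *)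
have run m n : (m <= n <= N)%N -> (forall i, (m <= i < n)%N -> ~~ (T <= a i.+1 - a i)) ->
    a n - a m <= eps * T.
  move=> /andP[mn nN] small.
  apply: (@le_trans _ _ (eps ^+ j.+1.*2.+1 *+ (n - m))).
    apply: increment_le => // i imn; have /andP[_ i_n] := imn.
    by apply/ltW/gapj; [exact: leq_trans nN | rewrite ltNge; exact: small].
  have -> : eps ^+ j.+1.*2.+1 = eps * T * eps by rewrite /T doubleS !exprSr; ring.
  rewrite -mulr_natr -mulrA; apply: ler_piMr; first by have [] := epsT.
  by apply: le_trans epsN; rewrite ler_pM2l// ler_nat (leq_trans (leq_subr _ _)).
have bN l : (l <= L)%N -> (b l <= N)%N.
  case: (ltngtP l L) => [/bP[_ /andP[/ltnW le1 le2]] _|//|-> _].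
    exact: leq_trans le1 le2.
  by rewrite bL.
have L_gt0 : (0 < L)%N.
  rewrite lt0n; apply/eqP => L0; have b0N : b 0%N = N by rewrite -bL L0.
  have : a N - a 0%N <= eps * T.
    by apply: run => [|i /andP[_ iN]]; [rewrite leqnn | apply: bgap0; rewrite b0N].
  by rewrite aN a0; lra.
pose s i := 2 * eps * i%:R.
have s_ge0 i : 0 <= s i by rewrite !mulr_ge0.
have s_le1 l : (l < L)%N -> s (b l) <= 1.
  move=> lL; apply: le_trans N_le; rewrite /s ler_pM2l ?mulr_gt0// ler_nat.
  by have [_ /andP[lt le]] := bP l lL; rewrite -ltnS prednK// (leq_trans lt).
(* Starting at 0 rather than at [a (b 0)] puts the initial short gaps into the first interval. *)
have [c [c0 cS]] : exists c : nat -> R, c 0%N = 0 /\ forall l, c l.+1 = a (b l.+1).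
  by exists (fun l => if l is 0%N then 0 else a (b l)).
have c01 l : c l \in `[0, 1] by case: l => [|l]; rewrite ?c0 ?cS// in_itv/=.
have c_le l : c l <= a (b l).
  by case: l => [|l]; rewrite ?c0 ?cS//; case/andP: (a01 (b 0%N)).
have c_ge l : (l < L)%N -> a (b l) - c l <= eps * T.
  case: l => [|l] lL; last by rewrite cS subrr; have [] := epsT.
  by rewrite c0 -a0; apply: run => //; rewrite bN.
have long l : (l < L)%N -> T <= a (b l).+1 - a (b l).
  by move=> /bP[].
have short_right l : (l < L)%N ->
    a (b l).+1 <= a (b l.+1) /\ a (b l.+1) - a (b l).+1 <= eps * T.
  move=> lL; have [_ /andP[lt le]] := bP l lL; split; first exact: amono.
  by apply: run => [|i i_b]; [rewrite lt le | exact: bgap i_b].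
have below l x : x \in `[0, 1] -> f (a (b l)) + s (b l) * (x - a (b l)) <= f x.
  by move=> x01; have [_] := amin (b l); exact.
have c_len l : (l < L)%N -> T <= c l.+1 - c l.
  move=> lL; have := long l lL; have [] := short_right l lL; have := c_le l.
  by rewrite cS; lra.
exists L, (fun l => c l.-1), (fun l => s (b l.-1)).
split=> //; split; [split=> //; split | split; [split=> //; split | split]] => /=.
- by rewrite -(prednK L_gt0) cS prednK// bL.
- by case=> // l /= lL; have := c_len l lL; lra.
- by apply: s_le1; rewrite prednK.
- case=> // l /andP[_ lL] /=; rewrite /s ltr_pM2l ?mulr_gt0// ltr_nat.
  by have [_ /andP[]] := bP l (ltnW lL).
- case=> // l /= lL.
  have cl := c_len l lL; have [sl0 sl1] := (s_ge0 (b l), s_le1 l lL).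
  have e1_ge0 := c_le l; have e1_le := c_ge l lL.
  split; first by lra.
  (* The supporting line passes through [a (b l)]; moving its base point back to [c l] costs
     [s (b l) * (a (b l) - c l)], at most [eps * T] as the slope is at most 1. *)
  + move=> x /andP[cx xc].
    have x01 : x \in `[0, 1].
      have := c01 l; have := c01 l.+1; rewrite !in_itv/= => /andP[_ ?] /andP[? _].
      by apply/andP; split; lra.
    have := below l x x01.
    have : f (c l) <= f (a (b l)) by apply: fhomo => //; rewrite in_itv/=.
    have : s (b l) * (a (b l) - c l) <= eps * T.
      by apply: le_trans e1_le; apply: ler_piMl; lra.
    have : eps * T <= eps * (c l.+1 - c l) by rewrite ler_pM2l.
    lra.
  (* Three pieces: slope [s (b l)] up to [a (b l)], slope [s (b l) + 2 * eps] on the long gap by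
     minimality at [(b l).+1], and the Lipschitz bound on the short gaps after it, at most
     [eps * T]. This gives the [3 * eps]. *)
  + have [e2_ge0 e2_le] := short_right l lL.
    have := below l _ (c01 l).
    have [ai1 /(_ (a (b l)))] := amin (b l).+1; rewrite in_itv/= a01 => /(_ isT).
    rewrite -natr1 -/(s _).
    have ci1 := c01 l.+1; rewrite cS in ci1 *.
    have := flip _ _ ci1 ai1; rewrite !ger0_norm ?subr_ge0//; last exact: fhomo.
    have := long l lL.
    have : 0 <= s (b l) * (a (b l.+1) - a (b l).+1) by rewrite mulr_ge0// subr_ge0.
    have : 0 <= eps * (a (b l.+1) - a (b l).+1) by rewrite mulr_ge0// subr_ge0.
    have : 0 <= eps * (a (b l) - c l) by rewrite mulr_ge0// subr_ge0.
    have : 0 <= eps * (a (b l).+1 - a (b l) - T) by rewrite mulr_ge0// subr_ge0 long.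
    rewrite /s /=; lra.
(* The supporting line of slope [s (b 0)] is evaluated at 1; its base point is within
   [eps * T <= eps] of 0. *)
- have := below 0%N _ in1; have := fhomo _ _ in0 (c01 1%N); have := s_le1 _ L_gt0.
  have := c_ge _ L_gt0; rewrite c0 subr0 => le.
  have : f 0 <= f (a (b 0%N))
    by apply: fhomo; rewrite ?in_itv/=//; case/andP: (a01 (b 0%N)).
  move=> ? sle _.
  have : s (b 0%N) * a (b 0%N) <= eps * T.
    by apply: le_trans le; apply: ler_piMl; case/andP: (a01 (b 0%N)).
  lra.
Qed.
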